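(* Let $A\in\mathbb{R}^{n\times n}$. Then $\det A=0$ if and only if for every $\varepsilon>0$ there exists $\mathbf{x}\in\mathbb{R}^n$ with $\lVert\mathbf{x}\rVert=1$ such that $\lVert A\mathbf{x}\rVert<\varepsilon$.
   Context: The setting is Bishop-style constructive mathematics (intuitionistic logic; the law of excluded middle is not available), with real numbers the constructive reals. $\lVert\mathbf{x}\rVert=\sqrt{\sum_i \mathbf{x}_i^2}$ is the Euclidean norm. *)

(* Defs.v *)
From Stdlib Require Import QArith Qabs Qround Qfield Lia Lqa.
From Stdlib.Reals.Abstract Require Import ConstructiveReals ConstructiveAbs
  ConstructiveLimits.

(* Constructive real analysis over the setoid-based interface
   [ConstructiveReals]: [==] is the defined equality of reals, [<] is the
   Set-valued (informative) strict order.  The interface has no square root,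
   so one is built here from completeness.  Existence is rendered by sigma types
   and equivalence by [iffT], since [<] lives in Set and witnesses must be
   computable from the data. *)

Local Open Scope ConstructiveReals.

Lemma Q_sqrt_approx (q : Q) (p : positive) :
  (0 <= q)%Q ->
  { s : Q | (0 <= s /\ s * s <= q /\ q < (s + (1#p)) * (s + (1#p)))%Q }.
Proof.
  intros Hq.
  set (d := inject_Z (Z.pos p)).
  set (m := Qfloor (q * (d * d))).
  assert (Hd : (0 < d)%Q) by (unfold d, Qlt; simpl; lia).
  assert (Hp : ((1#p) * d == 1)%Q).
  { unfold d, Qeq; simpl; lia. }
  assert (Hm0 : (0 <= m)%Z).
  { unfold m. change 0%Z with (Qfloor 0). apply Qfloor_resp_le. nra. }
  destruct (Z.sqrt_spec m Hm0) as [K1 K2].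
  pose proof (Z.sqrt_nonneg m) as K0.
  set (k := Z.sqrt m) in *.
  pose proof (Qfloor_le (q * (d * d))) as F1.
  pose proof (Qlt_floor (q * (d * d))) as F2.
  fold m in F1, F2.
  exists (inject_Z k * (1#p))%Q.
  rewrite Zle_Qle, inject_Z_mult in K1.
  assert (K2' : (m + 1 <= (k + 1) * (k + 1))%Z) by lia.
  rewrite Zle_Qle, inject_Z_mult, !(inject_Z_plus k) in K2'.
  rewrite Zle_Qle in K0. change (inject_Z 0) with 0%Q in K0.
  change (inject_Z 1) with 1%Q in K2'.
  set (kq := inject_Z k) in *. set (t := (1#p)) in *.
  assert (Ht : (0 < t)%Q) by (unfold t, Qlt; simpl; lia).
  assert (Ht2 : (0 < t * t)%Q) by nra.
  assert (E : (q == (q * (d * d)) * (t * t))%Q).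
  { transitivity (q * ((t * d) * (t * d)))%Q; [rewrite Hp|]; ring. }
  split; [nra|split].
  - rewrite E. setoid_replace (kq * t * (kq * t))%Q with ((kq * kq) * (t * t))%Q by ring.
    apply Qmult_le_compat_r; [lra|lra].
  - rewrite E.
    setoid_replace ((kq * t + t) * (kq * t + t))%Q with (((kq+1) * (kq+1)) * (t * t))%Q by ring.
    apply Qmult_lt_compat_r; [lra|lra].
Qed.

Section Sqrt.
Context {R : ConstructiveReals}.
Implicit Types x y : CRcarrier R.

Lemma CR_sqrt_approx x (p : positive) : 0 <= x ->
  { s : Q | (0 <= s)%Q
          /\ CR_of_Q R (s * s) <= x + CR_of_Q R ((1#p) * (1#p))
          /\ x <= CR_of_Q R ((s + (1#p)) * (s + (1#p))) }.
Proof.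
  intros Hx.
  assert (H : x < x + CR_of_Q R ((1#p) * (1#p))).
  { rewrite <- (CRplus_0_r x) at 1. apply CRplus_lt_compat_l.
    apply CR_of_Q_lt. reflexivity. }
  destruct (CR_Q_dense R _ _ H) as [q [H1 H2]].
  assert (Hq : (0 <= q)%Q).
  { apply Qlt_le_weak, (lt_CR_of_Q R). exact (CRle_lt_trans _ _ _ Hx H1). }
  destruct (Q_sqrt_approx q p Hq) as [s [S0 [S1 S2]]].
  exists s. split; [exact S0|split].
  - apply (CRle_trans _ (CR_of_Q R q)); [apply CR_of_Q_le, S1|apply CRlt_asym, H2].
  - apply (CRle_trans _ (CR_of_Q R q)); [apply CRlt_asym, H1|].
    apply CR_of_Q_le, Qlt_le_weak, S2.
Qed.

Lemma CRle_of_arch (a b : CRcarrier R) (c : positive) :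
  (forall p : positive, a <= b + CR_of_Q R ((1#p) * (Z.pos c # 1))) -> a <= b.
Proof.
  intros H abs.
  assert (D : 0 < a - b) by (apply CRlt_minus, abs).
  destruct (CR_Q_dense R _ _ D) as [q [Q1 Q2]].
  apply lt_CR_of_Q in Q1.
  destruct q as [qn qd].
  assert (Hn : (0 < qn)%Z) by (unfold Qlt in Q1; simpl in Q1; lia).
  apply (H (qd * c)%positive).
  apply (CRplus_lt_reg_l R (- b)).
  apply (CRle_lt_trans _ (CR_of_Q R (qn # qd))).
  - rewrite <- CRplus_assoc, CRplus_opp_l, CRplus_0_l.
    apply CR_of_Q_le. unfold Qle; simpl. nia.
  - rewrite CRplus_comm. exact Q2.
Qed.

Lemma CRsqr_le (a b : CRcarrier R) : 0 <= a -> a <= b -> a * a <= b * b.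
Proof.
  intros Ha Hab. apply (CRle_trans _ (a * b)).
  - apply CRmult_le_compat_l; assumption.
  - apply CRmult_le_compat_r; [apply (CRle_trans _ a)|]; assumption.
Qed.

Theorem CRsqrt_exists x : 0 <= x -> { r : CRcarrier R & prod (0 <= r) (r * r == x) }.
Proof.
  intros Hx.
  pose (P := fun n => Pos.of_succ_nat n).
  pose (s := fun n => proj1_sig (CR_sqrt_approx x (P n) Hx)).
  assert (S : forall n, (0 <= s n)%Q
          /\ CR_of_Q R (s n * s n) <= x + CR_of_Q R ((1#P n) * (1#P n))
          /\ x <= CR_of_Q R ((s n + (1#P n)) * (s n + (1#P n)))).
  { intro n. exact (proj2_sig (CR_sqrt_approx x (P n) Hx)). }
  assert (C1 : forall n m, (s n <= s m + (1#P m) + (1#P n))%Q).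
  { intros n m. destruct (S n) as [A0 [A1 _]], (S m) as [B0 [_ B2]].
    apply Qnot_lt_le. intro L.
    assert (Hm : (0 < 1#P m)%Q) by reflexivity.
    assert (Hn : (0 < 1#P n)%Q) by reflexivity.
    assert (F : ((s m + (1#P m)) * (s m + (1#P m)) + (1#P n) * (1#P n) < s n * s n)%Q).
    { set (u := (1#P n)%Q) in *. set (v := (1#P m)%Q) in *.
      set (a := s n) in *. set (b := s m) in *. nra. }
    apply (CR_of_Q_lt R) in F. revert F.
    change (CR_of_Q R (s n * s n) <=
      CR_of_Q R ((s m + (1#P m)) * (s m + (1#P m)) + (1#P n) * (1#P n))).
    rewrite (CR_of_Q_plus R ((s m + (1#P m)) * (s m + (1#P m)))).
    eapply CRle_trans; [exact A1|]. apply CRplus_le_compat_r, B2. }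
  assert (TP : forall p n, (Pos.to_nat p <= n)%nat -> ((1#P n) <= (1#p))%Q).
  { intros p n L. unfold Qle, P; simpl. lia. }
  assert (CC : CR_cauchy R (fun n => CR_of_Q R (s n))).
  { intro p. exists (Pos.to_nat (2 * p)). intros i j Hi Hj.
    apply TP in Hi, Hj.
    unfold CRminus. rewrite <- CR_of_Q_opp, <- CR_of_Q_plus, CR_of_Q_abs.
    apply CR_of_Q_le. pose proof (C1 i j). pose proof (C1 j i).
    assert (E : ((1#p) == (1#2*p) + (1#2*p))%Q)
      by (unfold Qeq; simpl; lia).
    rewrite E. apply Qabs_Qle_condition. split; lra. }
  destruct (CR_complete R _ CC) as [l Hl].
  assert (L0 : 0 <= l).
  { apply (CR_cv_bound_down (fun n => CR_of_Q R (s n)) _ _ 0); [|exact Hl].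
    intros n _. apply CR_of_Q_le, S. }
  assert (LU : forall n, l <= CR_of_Q R (s n + 2 * (1#P n))).
  { intro n. apply (CR_cv_bound_up (fun n => CR_of_Q R (s n)) _ _ n); [|exact Hl].
    intros m Hm. apply CR_of_Q_le. pose proof (C1 m n).
    assert ((1#P m) <= (1#P n))%Q by (unfold Qle, P; simpl; lia). lra. }
  assert (LD : forall n, CR_of_Q R (s n) <= l + CR_of_Q R (2 * (1#P n))).
  { intro n.
    apply (CRplus_le_reg_r (CR_of_Q R (- (2 * (1#P n))))).
    rewrite CRplus_assoc, <- !CR_of_Q_plus.
    rewrite Qplus_opp_r, CRplus_0_r.
    apply (CR_cv_bound_down (fun n => CR_of_Q R (s n)) _ _ n); [|exact Hl].
    intros m Hm. apply CR_of_Q_le. pose proof (C1 n m).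
    assert ((1#P m) <= (1#P n))%Q by (unfold Qle, P; simpl; lia). lra. }
  destruct (CR_archimedean R l) as [b Hb].
  assert (SB : forall n, (s n <= (Z.pos b # 1) + 2)%Q).
  { intro n. apply Qnot_lt_le. intro F. apply (CR_of_Q_lt R) in F. revert F.
    change (CR_of_Q R (s n) <= CR_of_Q R ((Z.pos b # 1) + 2)).
    eapply CRle_trans; [apply LD|]. rewrite CR_of_Q_plus.
    apply CRplus_le_compat; [apply CRlt_asym, Hb|].
    apply CR_of_Q_le. unfold Qle; simpl. lia. }
  assert (PS : forall p, exists n, P n = p).
  { intro p. exists (Pos.to_nat p - 1)%nat. unfold P. lia. }
  exists l. split; [exact L0|]. split.
  - apply (CRle_of_arch _ _ (10 * b + 100)). intro p. destruct (PS p) as [n <-].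
    destruct (S n) as [S0 [S1 S2]].
    eapply CRle_trans; [exact S2|].
    set (t := (1#P n)%Q) in *.
    assert (Ht : (0 < t)%Q) by reflexivity.
    assert (Ht1 : (t <= 1)%Q) by (unfold t, Qle; simpl; lia).
    destruct (Qlt_le_dec (s n) (2 * t)) as [Z|Z].
    + apply (CRle_trans _ (0 + CR_of_Q R (t * (Z.pos (10 * b + 100) # 1)))).
      * rewrite CRplus_0_l. apply CR_of_Q_le.
        assert (H : (100 <= Z.pos (10 * b + 100) # 1)%Q) by (unfold Qle; simpl; lia).
        nra.
      * apply CRplus_le_compat_r. apply CRmult_le_0_compat; exact L0.
    + apply (CRle_trans _ (CR_of_Q R ((s n - 2 * t) * (s n - 2 * t))
                             + CR_of_Q R (t * (Z.pos (10 * b + 100) # 1)))).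
      * rewrite <- CR_of_Q_plus. apply CR_of_Q_le. pose proof (SB n) as B.
        assert (E : ((Z.pos (10 * b + 100) # 1) == 10 * (Z.pos b # 1) + 100)%Q)
          by (unfold Qeq; simpl; lia).
        rewrite E. set (bq := (Z.pos b # 1)%Q) in *.
        assert (s n * t <= (bq + 2) * t)%Q by nra. nra.
      * apply CRplus_le_compat_r. rewrite CR_of_Q_mult.
        apply CRsqr_le.
        -- apply CR_of_Q_le. lra.
        -- apply (CRplus_le_reg_r (CR_of_Q R (2 * t))).
           rewrite <- CR_of_Q_plus.
           setoid_replace (s n - 2 * t + 2 * t)%Q with (s n) by ring.
           apply LD.
  - apply (CRle_of_arch _ _ (10 * b + 100)). intro p. destruct (PS p) as [n <-].
    destruct (S n) as [S0 [S1 S2]].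
    set (t := (1#P n)%Q) in *.
    assert (Ht : (0 < t)%Q) by reflexivity.
    assert (Ht1 : (t <= 1)%Q) by (unfold t, Qle; simpl; lia).
    apply (CRle_trans _ (CR_of_Q R ((s n + 2 * t) * (s n + 2 * t)))).
    + rewrite CR_of_Q_mult. apply CRsqr_le; [exact L0|apply LU].
    + apply (CRle_trans _ (CR_of_Q R (s n * s n)
                 + CR_of_Q R (t * (Z.pos (10 * b + 100) # 1) - t * t))).
      * rewrite <- CR_of_Q_plus. apply CR_of_Q_le. pose proof (SB n) as B.
        assert (E : ((Z.pos (10 * b + 100) # 1) == 10 * (Z.pos b # 1) + 100)%Q)
          by (unfold Qeq; simpl; lia).
        rewrite E. set (bq := (Z.pos b # 1)%Q) in *.
        assert (s n * t <= (bq + 2) * t)%Q by nra. nra.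
      * eapply CRle_trans; [apply CRplus_le_compat_r, S1|].
        rewrite CRplus_assoc, <- CR_of_Q_plus.
        apply CRplus_le_compat_l, CR_of_Q_le. lra.
Qed.

Definition CRsqrt x (x_ge0 : 0 <= x) : CRcarrier R := projT1 (CRsqrt_exists x x_ge0).

(* [CRsqrt] rests on an opaque construction; these two facts determine it up to
   [==]. *)
Lemma CRsqrt_ge0 x (x_ge0 : 0 <= x) : 0 <= CRsqrt x x_ge0.
Proof. exact (fst (projT2 (CRsqrt_exists x x_ge0))). Qed.

Lemma CRsqrt_sqr x (x_ge0 : 0 <= x) : CRsqrt x x_ge0 * CRsqrt x x_ge0 == x.
Proof. exact (snd (projT2 (CRsqrt_exists x x_ge0))). Qed.

Lemma CRsqr_ge0 x : 0 <= x * x.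
Proof.
  intro H.
  assert (N : x * x <= 0) by (apply CRlt_asym, H).
  assert (A : x <= 0).
  { intro L. apply N. apply CRmult_lt_0_compat; exact L. }
  assert (B : 0 <= x).
  { intro L. apply N.
    apply CRopp_gt_lt_contravar in L. rewrite CRopp_0 in L.
    assert (E : x * x == (- x) * (- x)).
    { rewrite <- CRopp_mult_distr_l, <- CRopp_mult_distr_r, CRopp_involutive.
      reflexivity. }
    rewrite E. apply CRmult_lt_0_compat; exact L. }
  assert (E : x == 0) by (split; assumption).
  rewrite E, CRmult_0_l in H. exact (CRle_refl _ H).
Qed.

End Sqrt.

From mathcomp Require Import all_boot all_fingroup all_algebra.

Set Implicit Arguments.
Unset Strict Implicit.
Unset Printing Implicit Defensive.

Local Open Scope ConstructiveReals.

(* MathComp's matrix types accept any entry type, but [\det] and [*m] need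
   a ring up to Leibniz equality, which the setoid [CRcarrier R] is not; they
   are restated with MathComp's own formulas over the operations of [R]. *)

Section LinearAlgebra.
Context {R : ConstructiveReals}.

Definition CRdet (n : nat) (A : 'M[CRcarrier R]_n) : CRcarrier R :=
  \big[CRplus R/0]_(s : 'S_n)
    ((if odd_perm s then CRopp R 1 else 1) * \big[CRmult R/1]_(i < n) A i (s i)).

Definition CRmulmv (m n : nat) (A : 'M[CRcarrier R]_(m, n))
    (x : 'cV[CRcarrier R]_n) : 'cV[CRcarrier R]_m :=
  \col_(i < m) \big[CRplus R/0]_(j < n) (A i j * x j ord0).

Definition CRsumsq (n : nat) (x : 'cV[CRcarrier R]_n) : CRcarrier R :=
  \big[CRplus R/0]_(i < n) (x i ord0 * x i ord0).

Lemma CRsumsq_ge0 (n : nat) (x : 'cV[CRcarrier R]_n) : 0 <= CRsumsq x.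
Proof.
apply: (big_ind (fun y : CRcarrier R => 0 <= y)).
- exact: CRle_refl.
- move=> a b Ha Hb; apply: (CRle_trans _ (0 + 0)).
    by case: (CRplus_0_l (0 : CRcarrier R)).
  exact: CRplus_le_compat.
- by move=> i _; exact: CRsqr_ge0.
Qed.

Definition CRnorm (n : nat) (x : 'cV[CRcarrier R]_n) : CRcarrier R :=
  CRsqrt (CRsumsq x) (@CRsumsq_ge0 n x).

End LinearAlgebra.

(* Main.v *)
Require Import Defs.
From Stdlib Require Import QArith ZArith Lia.
From Stdlib Require Import ConstructiveReals ConstructiveAbs ConstructiveLimits.
From mathcomp Require Import all_boot all_fingroup all_algebra.
From mathcomp Require Import ssrZ zify.

(** The proof is constructive and uses no axiom.  Equality of reals is not
    decidable, so Gaussian elimination on [A] and exact kernel vectors are out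
    of reach; instead [A] is approximated by rational matrices, for which
    [det B = 0] is decidable and classical linear algebra holds.  Two facts
    connect the two worlds: [ratR] is a ring morphism from the rationals to the
    reals, and polynomial expressions such as the determinant are continuous
    ([CR_cv_det]).

    If the vectors [x] exist, then [det A = 0] by Cramer's rule
    [adj A * (A x) = det A * x] ([CRcofactor_mulmv]): for a unit vector [x] it
    bounds [|det A|] by [|A x|] times the sum of the absolute values of the
    cofactors ([CRabs_det_le]).  Cramer's rule itself is a polynomial identity,
    so it passes from rational matrices to real ones by taking limits.

    Conversely, let [det A = 0], and let [B] be a rational approximation of
    [A], close enough that [det B] is small.  It suffices to find a rational
    [y] that is much longer than [B y] ([rat_stretch]); its normalization is
    then nearly annihilated by [B], hence by [A] ([small_vector]).
    If [det B = 0], such a [y] is a large multiple of a kernel vector.  If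
    [det B] is not zero, then [det B^-1] is large, so [B^-1] cannot have
    small entries only; since [B] sends column [j] of [B^-1] to the [j]-th
    basis vector, a column with a large entry can be taken as [y]. *)

Set Implicit Arguments.
Unset Strict Implicit.
Unset Printing Implicit Defensive.

Import GRing.Theory.

Local Open Scope ConstructiveReals.

#[local] Hint Resolve CReq_refl CRle_refl : core.

(** * Rational numbers as fractions *)

Definition Q_of_rat (x : rat) : Q :=
  Qmake (Z_of_int (numq x)) (Z.to_pos (Z_of_int (denq x))).

Definition rat_of_Q (q : Q) : rat :=
  ((int_of_Z (Qnum q))%:~R / (int_of_Z (Z.pos (Qden q)))%:~R)%R.

Lemma Q_of_ratK : cancel Q_of_rat rat_of_Q.
Proof.
move=> x; have dp : Z.lt Z0 (Z_of_int (denq x)) by have := denq_gt0 x; lia.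
by rewrite /rat_of_Q [Qnum _]/= [Qden _]/= Z2Pos.id // !Z_of_intK divq_num_den.
Qed.

Lemma Qden_neq0 (q : Q) : ((int_of_Z (Z.pos (Qden q)))%:~R != 0 :> rat)%R.
Proof. by rewrite intr_eq0; lia. Qed.

Lemma rat_of_QK (q : Q) : Qeq (Q_of_rat (rat_of_Q q)) q.
Proof.
set x := rat_of_Q q.
have dp : Z.lt Z0 (Z_of_int (denq x)) by have := denq_gt0 x; lia.
have E : (numq x * int_of_Z (Z.pos (Qden q)) = int_of_Z (Qnum q) * denq x)%R.
  apply: (@intr_inj rat); rewrite !intrM numqE mulrAC; congr (_ * _)%R.
  by rewrite divfK // Qden_neq0.
have := congr1 Z_of_int E; rewrite !rmorphM /= !int_of_ZK => {}E.
by rewrite /Qeq /= Z2Pos.id // -[RHS]E; congr Z.mul; lia.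
Qed.

Lemma rat_of_QD p q : rat_of_Q (Qplus p q) = (rat_of_Q p + rat_of_Q q)%R.
Proof.
rewrite /rat_of_Q addf_div ?Qden_neq0 // -!intrM -intrD.
by rewrite -!rmorphM -rmorphD.
Qed.

Lemma rat_of_QM p q : rat_of_Q (Qmult p q) = (rat_of_Q p * rat_of_Q q)%R.
Proof. by rewrite /rat_of_Q mulf_div -!intrM -!rmorphM. Qed.

Section DetZero.
Context {R : ConstructiveReals}.
Implicit Types a b c d M : CRcarrier R.

Add Ring CRring : (CRisRing R).

(** * Order and finite sums of constructive reals *)

Lemma CRle_0_1 : CRle R 0 1.
Proof. by apply: CRlt_asym; exact: CRzero_lt_one. Qed.

Lemma CRplus_ge0 a b : 0 <= a -> 0 <= b -> 0 <= a + b.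
Proof.
move=> a0 b0; apply: (CRle_trans _ (0 + 0)); first by rewrite CRplus_0_l.
exact: CRplus_le_compat.
Qed.

Lemma CRsqr_lt a b : 0 <= a -> a < b -> a * a < b * b.
Proof.
move=> a0 ab; apply: (CRle_lt_trans _ (a * b)).
  by apply: CRmult_le_compat_l => //; exact: CRlt_asym.
by apply: CRmult_lt_compat_r => //; exact: CRle_lt_trans ab.
Qed.

Lemma CRle_of_sqr a b : 0 <= b -> a * a <= b * b -> a <= b.
Proof. by move=> b0 ab /(CRsqr_lt b0). Qed.

Lemma CReq_of_sqr a b : 0 <= a -> 0 <= b -> a * a == b * b -> a == b.
Proof. by move=> a0 b0 [ba ab]; split; exact: CRle_of_sqr. Qed.

Lemma CRsqr_abs a : CRabs R a * CRabs R a == a * a.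
Proof. by rewrite -CRabs_mult CRabs_right //; exact: CRsqr_ge0. Qed.

Lemma CRabs_le0_eq0 a : CRabs R a <= 0 -> a == 0.
Proof.
case/(proj2 (CRabs_def R a 0)) => a_le0 Na_le0; split=> //.
apply: CRle_trans (_ : - 0 <= _); first by rewrite CRopp_0.
by rewrite -[X in _ <= X]CRopp_involutive; exact: CRopp_ge_le_contravar.
Qed.

Lemma eq_CRsum (I : finType) (F G : I -> CRcarrier R) :
  (forall i, F i == G i) ->
  \big[CRplus R/0]_i F i == \big[CRplus R/0]_i G i.
Proof.
move=> FG; apply: (big_ind2 (fun a b => a == b)) => //.
by move=> a b c d -> ->.
Qed.

Lemma CRsum_mull (I : finType) c (F : I -> CRcarrier R) :
  c * (\big[CRplus R/0]_i F i) == \big[CRplus R/0]_i (c * F i).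
Proof.
apply: (big_ind2 (fun a b => c * a == b)) => //; first by ring.
by move=> a b d e <- <-; ring.
Qed.

Lemma CRsum_add (I : finType) (F G : I -> CRcarrier R) :
  \big[CRplus R/0]_i (F i + G i) ==
  \big[CRplus R/0]_i F i + \big[CRplus R/0]_i G i.
Proof.
apply: (big_rec3 (fun a b c => c == a + b)); first by ring.
by move=> i a b c _ ->; ring.
Qed.

Lemma CRsum_le (I : finType) (F G : I -> CRcarrier R) :
  (forall i, F i <= G i) ->
  \big[CRplus R/0]_i F i <= \big[CRplus R/0]_i G i.
Proof.
move=> FG; apply: (big_ind2 (fun a b => a <= b)) => // a b c d.
exact: CRplus_le_compat.
Qed.

Lemma CRsum_ge0 (I : finType) (F : I -> CRcarrier R) :
  (forall i, 0 <= F i) -> 0 <= \big[CRplus R/0]_i F i.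
Proof.
by move=> F0; apply: (big_ind (fun a => 0 <= a)) => // a b; exact: CRplus_ge0.
Qed.

Lemma CRabs_sum (I : finType) (F : I -> CRcarrier R) :
  CRabs R (\big[CRplus R/0]_i F i) <= \big[CRplus R/0]_i CRabs R (F i).
Proof.
apply: (big_ind2 (fun a b => CRabs R a <= b)) => //.
  by rewrite CRabs_right.
move=> a b c d ab cd; apply: CRle_trans (CRabs_triang _ _) _.
exact: CRplus_le_compat.
Qed.
Arguments CRabs_sum {I} F.

Lemma CRterm_le_sum (I : finType) (F : I -> CRcarrier R) j :
  (forall i, 0 <= F i) -> F j <= \big[CRplus R/0]_i F i.
Proof.
move=> F0; have: j \in index_enum I by rewrite mem_index_enum.
elim: (index_enum I) => // i s IHs; rewrite inE big_cons.
have s0 : 0 <= \big[CRplus R/0]_(i <- s) F i.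
  by apply: (big_ind (fun a => 0 <= a)) => // a b; exact: CRplus_ge0.
case/predU1P => [-> | /IHs js].
  by rewrite -{1}[F i]CRplus_0_r; apply: CRplus_le_compat.
by rewrite -{1}[F j]CRplus_0_l; apply: CRplus_le_compat.
Qed.

Lemma CRsum_const n (q : Q) :
  \big[CRplus R/0]_(i < n) CR_of_Q R q == CR_of_Q R ((Z.of_nat n # 1) * q).
Proof.
elim: n => [|n IHn].
  by rewrite big_ord0 Qmult_0_l.
rewrite big_ord_recl IHn -CR_of_Q_plus; apply: CR_of_Q_morph.
case: q {IHn} => a b; rewrite Nat2Z.inj_succ /Qeq /=; lia.
Qed.

(** A single comparison [f i <= M] cannot be decided, but given [M < M'] one can
    decide between [M < f i] and [f i < M']; the gap makes the search over [I]
    effective. *)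
Lemma exists_gt_or_all_le (I : finType) (f : I -> CRcarrier R) M M' :
  M < M' -> {i : I & M < f i} + (forall i, f i <= M').
Proof.
move=> MM'.
suff: {i : I & M < f i} + (forall i, i \in index_enum I -> f i <= M').
  by case=> [|small]; [left | right=> i; apply: small; rewrite mem_index_enum].
elim: (index_enum I) => [|i s [large|small]]; [by right | by left |].
case: (CRltLinear R) => _ /(_ _ (f i) _ MM') [Mfi | fiM'].
  by left; exists i.
by right=> j /predU1P[-> | /small //]; exact: CRlt_asym.
Qed.

(** * Euclidean norm *)

Lemma CRnorm_ge0 n (x : 'cV[CRcarrier R]_n) : 0 <= CRnorm x.
Proof. exact: CRsqrt_ge0. Qed.

Lemma CRnorm_sqr n (x : 'cV[CRcarrier R]_n) : CRnorm x * CRnorm x == CRsumsq x.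
Proof. exact: CRsqrt_sqr. Qed.

Lemma CRabs_le_norm n (x : 'cV[CRcarrier R]_n) i :
  CRabs R (x i ord0) <= CRnorm x.
Proof.
apply: CRle_of_sqr; first exact: CRnorm_ge0.
rewrite CRsqr_abs CRnorm_sqr.
apply: (CRterm_le_sum (F := fun i => x i ord0 * x i ord0)) => j.
exact: CRsqr_ge0.
Qed.
Arguments CRabs_le_norm {n} x i.

Lemma CRnorm_le_sum n (x : 'cV[CRcarrier R]_n) :
  CRnorm x <= \big[CRplus R/0]_(i < n) CRabs R (x i ord0).
Proof.
apply: CRle_of_sqr; first by apply: CRsum_ge0 => i; exact: CRabs_pos.
rewrite CRnorm_sqr.
suff [] : CRsumsq x <= (\big[CRplus R/0]_(i < n) CRabs R (x i ord0))
    * (\big[CRplus R/0]_(i < n) CRabs R (x i ord0)) /\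
    0 <= \big[CRplus R/0]_(i < n) CRabs R (x i ord0) by [].
apply: (big_ind2 (fun a b => a <= b * b /\ 0 <= b)).
- by split=> //; rewrite CRmult_0_l.
- move=> a b c d [ab b0] [cd d0]; split; last exact: CRplus_ge0.
  apply: (CRle_trans _ (b * b + d * d)); first exact: CRplus_le_compat.
  have -> : (b + d) * (b + d) == (b * b + d * d) + (b * d + b * d) by ring.
  rewrite -{1}[b * b + _]CRplus_0_r; apply: CRplus_le_compat_l.
  by apply: CRplus_ge0; exact: CRmult_le_0_compat.
- by move=> i _; rewrite CRsqr_abs; split=> //; exact: CRabs_pos.
Qed.

Lemma CRnorm_scale n (x : 'cV[CRcarrier R]_n) t : 0 <= t ->
  CRnorm (\col_i (t * x i ord0)) == t * CRnorm x.
Proof.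
move=> t0; apply: CReq_of_sqr; [exact: CRnorm_ge0| |].
  by apply: CRmult_le_0_compat => //; exact: CRnorm_ge0.
have -> : t * CRnorm x * (t * CRnorm x) == t * t * (CRnorm x * CRnorm x) by ring.
rewrite !CRnorm_sqr CRsum_mull; apply: eq_CRsum => i.
by rewrite mxE; ring.
Qed.

Lemma CRmulmv_scale m n (A : 'M[CRcarrier R]_(m, n)) (x : 'cV[CRcarrier R]_n)
    t i :
  CRmulmv A (\col_j (t * x j ord0)) i ord0 == t * CRmulmv A x i ord0.
Proof.
by rewrite !mxE CRsum_mull; apply: eq_CRsum => j; rewrite mxE; ring.
Qed.

Lemma CRabs_mulmv_le m n (A B : 'M[CRcarrier R]_(m, n)) (x : 'cV[CRcarrier R]_n)
    d i :
  (forall j, CRabs R (A i j - B i j) <= d) ->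
  (forall j, CRabs R (x j ord0) <= 1) ->
  CRabs R (CRmulmv A x i ord0) <=
  \big[CRplus R/0]_(j < n) d + CRabs R (CRmulmv B x i ord0).
Proof.
move=> ABd x1.
have -> : CRmulmv A x i ord0 ==
    \big[CRplus R/0]_(j < n) ((A i j - B i j) * x j ord0) + CRmulmv B x i ord0.
  rewrite !mxE -CRsum_add; apply: eq_CRsum => j; rewrite /CRminus; ring.
apply: CRle_trans (CRabs_triang _ _) _; apply: CRplus_le_compat => //.
apply: CRle_trans (CRabs_sum _) _; apply: CRsum_le => j.
rewrite CRabs_mult -[d]CRmult_1_r.
apply: (CRle_trans _ (CRabs R (A i j - B i j) * 1)).
  by apply: CRmult_le_compat_l => //; exact: CRabs_pos.
by apply: CRmult_le_compat_r => //; exact: CRle_0_1.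
Qed.

(** * The embedding of the rationals into the reals *)

Definition ratR (x : rat) : CRcarrier R := CR_of_Q R (Q_of_rat x).

Lemma ratR_of_Q q : ratR (rat_of_Q q) == CR_of_Q R q.
Proof. exact/CR_of_Q_morph/rat_of_QK. Qed.

Lemma ratRD x y : ratR (x + y)%R == ratR x + ratR y.
Proof. by rewrite -CR_of_Q_plus -ratR_of_Q rat_of_QD !Q_of_ratK. Qed.

Lemma ratRM x y : ratR (x * y)%R == ratR x * ratR y.
Proof. by rewrite -CR_of_Q_mult -ratR_of_Q rat_of_QM !Q_of_ratK. Qed.

Lemma ratR0 : ratR 0%R = 0.
Proof. by []. Qed.

Lemma ratR1 : ratR 1%R = 1.
Proof. by []. Qed.

Lemma ratRN1 : ratR (-1)%R == - (1).
Proof. by rewrite -CR_of_Q_opp. Qed.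

Lemma ratR_sum (I : finType) (F : I -> rat) :
  ratR (\sum_i F i)%R == \big[CRplus R/0]_i ratR (F i).
Proof.
apply: (big_ind2 (fun x a => ratR x == a)) => // x a y b xa yb.
by rewrite ratRD xa yb.
Qed.

Lemma ratR_prod (I : finType) (F : I -> rat) :
  ratR (\prod_i F i)%R == \big[CRmult R/1]_i ratR (F i).
Proof.
apply: (big_ind2 (fun x a => ratR x == a)) => // x a y b xa yb.
by rewrite ratRM xa yb.
Qed.

Lemma ratR_sign (b : bool) :
  ratR ((-1) ^+ b)%R == (if b then CRopp R 1 else 1).
Proof. by case: b; rewrite ?expr1 ?expr0 ?ratRN1. Qed.

Lemma ratR_det n (B : 'M[rat]_n) :
  ratR (\det B)%R == CRdet (map_mx ratR B).
Proof.
rewrite ratR_sum; apply: eq_CRsum => s.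
rewrite ratRM ratR_sign ratR_prod.
suff -> : \big[CRmult R/1]_i ratR (B i (s i)) =
  \big[CRmult R/1]_i (map_mx ratR B) i (s i) by [].
by apply: eq_bigr => i _; rewrite mxE.
Qed.

Lemma ratR_mulmv m n (B : 'M[rat]_(m, n)) (y : 'cV[rat]_n) i :
  ratR ((B *m y)%R i ord0) ==
  CRmulmv (map_mx ratR B) (map_mx ratR y) i ord0.
Proof.
rewrite !mxE ratR_sum; apply: eq_CRsum => j.
by rewrite !mxE ratRM.
Qed.

Definition CRcofactor n (A : 'M[CRcarrier R]_n) (i j : 'I_n) : CRcarrier R :=
  (if odd (i + j) then CRopp R 1 else 1) * CRdet (row' i (col' j A)).

Lemma ratR_cofactor n (B : 'M[rat]_n) i j :
  ratR (cofactor B i j) == CRcofactor (map_mx ratR B) i j.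
Proof.
rewrite ratRM -signr_odd ratR_sign ratR_det.
by rewrite /CRcofactor -map_col' -map_row'.
Qed.

(** * Continuity of matrix expressions *)

Lemma CR_cv_null_mul (u v : nat -> CRcarrier R) :
  CR_cv R u 0 -> CR_cv R v 0 -> CR_cv R (fun k => u k * v k) 0.
Proof.
move=> u0 v0 p.
case: (u0 1%positive) => N1 H1; case: (v0 p) => N2 H2.
exists (maxn N1 N2) => k /leP; rewrite geq_max => /andP[/leP/H1 {}H1 /leP/H2].
move: H1; rewrite /CRminus CRopp_0 !CRplus_0_r CRabs_mult => H1 {}H2.
rewrite -[CR_of_Q R _]CRmult_1_l.
apply: CRle_trans (CRmult_le_compat_l _ _ _ _ H2) _; first exact: CRabs_pos.
apply: CRmult_le_compat_r => //.
exact: CR_of_Q_le.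
Qed.

Lemma CR_cv_mult (u v : nat -> CRcarrier R) a b :
  CR_cv R u a -> CR_cv R v b -> CR_cv R (fun k => u k * v k) (a * b).
Proof.
move=> ua vb.
have ua0 : CR_cv R (fun k => u k - a) 0.
  apply: CR_cv_proper (CR_cv_minus _ _ _ _ ua (CR_cv_const a)) _.
  by rewrite /CRminus; ring.
have vb0 : CR_cv R (fun k => v k - b) 0.
  apply: CR_cv_proper (CR_cv_minus _ _ _ _ vb (CR_cv_const b)) _.
  by rewrite /CRminus; ring.
(* u v = (u - a) (v - b) + b u + a (v - b) *)
have H := CR_cv_plus _ _ _ _ (CR_cv_null_mul ua0 vb0)
  (CR_cv_plus _ _ _ _ (CR_cv_scale _ b _ ua) (CR_cv_scale _ a _ vb0)).
by apply: CR_cv_proper (CR_cv_extens _ _ _ _ H) _ => [k|];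
  rewrite /CRminus; ring.
Qed.

Lemma CR_cv_sum (I : finType) (F : nat -> I -> CRcarrier R)
    (G : I -> CRcarrier R) :
  (forall i, CR_cv R (F^~ i) (G i)) ->
  CR_cv R (fun k => \big[CRplus R/0]_i F k i) (\big[CRplus R/0]_i G i).
Proof.
move=> FG; elim: (index_enum I) => [|i s IHs].
  by rewrite big_nil; apply: CR_cv_extens (CR_cv_const 0) => k; rewrite big_nil.
rewrite big_cons; apply: CR_cv_extens (CR_cv_plus _ _ _ _ (FG i) IHs) => k.
by rewrite big_cons.
Qed.

Lemma CR_cv_prod (I : finType) (F : nat -> I -> CRcarrier R)
    (G : I -> CRcarrier R) :
  (forall i, CR_cv R (F^~ i) (G i)) ->
  CR_cv R (fun k => \big[CRmult R/1]_i F k i) (\big[CRmult R/1]_i G i).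
Proof.
move=> FG; elim: (index_enum I) => [|i s IHs].
  by rewrite big_nil; apply: CR_cv_extens (CR_cv_const 1) => k; rewrite big_nil.
rewrite big_cons; apply: CR_cv_extens (CR_cv_mult (FG i) IHs) => k.
by rewrite big_cons.
Qed.

Lemma CR_cv_det n (B : nat -> 'M[CRcarrier R]_n) (A : 'M[CRcarrier R]_n) :
  (forall i j, CR_cv R (fun k => B k i j) (A i j)) ->
  CR_cv R (fun k => CRdet (B k)) (CRdet A).
Proof.
move=> BA; apply: CR_cv_sum => s; apply: CR_cv_mult (CR_cv_const _) _.
exact: CR_cv_prod.
Qed.

Lemma CR_cv_mulmv m n (B : nat -> 'M[CRcarrier R]_(m, n))
    (A : 'M[CRcarrier R]_(m, n)) (y : nat -> 'cV[CRcarrier R]_n)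
    (x : 'cV[CRcarrier R]_n) i :
  (forall i j, CR_cv R (fun k => B k i j) (A i j)) ->
  (forall j, CR_cv R (fun k => y k j ord0) (x j ord0)) ->
  CR_cv R (fun k => CRmulmv (B k) (y k) i ord0) (CRmulmv A x i ord0).
Proof.
move=> BA yx; rewrite mxE; apply: (CR_cv_extens (fun k =>
  \big[CRplus R/0]_(j < n) (B k i j * y k j ord0))) => [k|].
  by rewrite mxE.
by apply: CR_cv_sum => j; apply: CR_cv_mult.
Qed.

Lemma CR_cv_cofactor n (B : nat -> 'M[CRcarrier R]_n) (A : 'M[CRcarrier R]_n)
    i j :
  (forall i j, CR_cv R (fun k => B k i j) (A i j)) ->
  CR_cv R (fun k => CRcofactor (B k) i j) (CRcofactor A i j).
Proof.
move=> BA; apply: CR_cv_mult (CR_cv_const _) _; apply: CR_cv_det => i' j'.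
rewrite !mxE; apply: CR_cv_extens (BA (lift i i') (lift j j')) => k.
by rewrite !mxE.
Qed.

(** * Rational approximations of a real matrix *)

Lemma rat_approx a (k : nat) :
  {q : rat | CRabs R (ratR q - a) <= CR_of_Q R (1 # Pos.of_succ_nat k)}.
Proof.
have lt_a : a < a + CR_of_Q R (1 # Pos.of_succ_nat k).
  by rewrite -{1}[a]CRplus_0_r; apply: CRplus_lt_compat_l; apply: CR_of_Q_lt.
have [q [aq qa]] := CR_Q_dense R _ _ lt_a.
exists (rat_of_Q q); rewrite ratR_of_Q CRabs_right.
  apply: (CRplus_le_reg_l a); rewrite /CRminus.
  have -> : a + (CR_of_Q R q + - a) == CR_of_Q R q by ring.
  exact: CRlt_asym.
exact/CRlt_asym/CRlt_minus.
Qed.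

Definition rat_mx m n (A : 'M[CRcarrier R]_(m, n)) k : 'M[rat]_(m, n) :=
  map_mx (fun a => sval (rat_approx a k)) A.

Lemma rat_mx_close m n (A : 'M[CRcarrier R]_(m, n)) (p : positive) k i j :
  (Pos.to_nat p <= k)%N ->
  CRabs R (map_mx ratR (rat_mx A k) i j - A i j) <= CR_of_Q R (1 # p).
Proof.
move=> pk; rewrite !mxE.
apply: CRle_trans (svalP (rat_approx (A i j) k)) _; apply: CR_of_Q_le.
by rewrite /Qle /=; lia.
Qed.

Lemma rat_mx_cv m n (A : 'M[CRcarrier R]_(m, n)) i j :
  CR_cv R (fun k => map_mx ratR (rat_mx A k) i j) (A i j).
Proof. by move=> p; exists (Pos.to_nat p) => k /leP; exact: rat_mx_close. Qed.

(** * Arbitrarily small images force the determinant to vanish *)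

(** Cramer's rule.  The identity holds for the rational approximations of [A]
    and [x], and both sides are continuous in [A] and [x]. *)
Lemma CRcofactor_mulmv n (A : 'M[CRcarrier R]_n) x i :
  \big[CRplus R/0]_j (CRcofactor A j i * CRmulmv A x j ord0) ==
  CRdet A * x i ord0.
Proof.
pose B k := map_mx ratR (rat_mx A k) : 'M[CRcarrier R]_n.
pose y k := map_mx ratR (rat_mx x k) : 'cV[CRcarrier R]_n.
have By k : CRdet (B k) * y k i ord0 ==
    \big[CRplus R/0]_j (CRcofactor (B k) j i * CRmulmv (B k) (y k) j ord0).
  rewrite -ratR_det [y k i ord0]mxE -ratRM.
  have -> : (\det (rat_mx A k) * rat_mx x k i ord0)%R =
      (\adj (rat_mx A k) *m (rat_mx A k *m rat_mx x k))%R i ord0.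
    by rewrite mulmxA mul_adj_mx mul_scalar_mx [RHS]mxE.
  rewrite [X in ratR X]mxE ratR_sum; apply: eq_CRsum => j.
  by rewrite ratRM [X in ratR X * _]mxE ratR_cofactor ratR_mulmv.
apply: (CR_cv_unique (fun k => CRdet (B k) * y k i ord0)).
- apply: CR_cv_extens (CR_cv_sum _) => [k|j]; first exact: CReq_sym (By k).
  apply: CR_cv_mult; first by apply: CR_cv_cofactor => ? ?; exact: rat_mx_cv.
  by apply: CR_cv_mulmv => *; exact: rat_mx_cv.
- apply: CR_cv_mult; last exact: rat_mx_cv.
  by apply: CR_cv_det => ? ?; exact: rat_mx_cv.
Qed.

Lemma CRabs_det_le n (A : 'M[CRcarrier R]_n) x e :
  CRnorm x == 1 -> CRnorm (CRmulmv A x) <= e ->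
  CRabs R (CRdet A) <=
  e * \big[CRplus R/0]_i \big[CRplus R/0]_j CRabs R (CRcofactor A j i).
Proof.
move=> x1 Axe.
(* Multiplying by |x|^2 = 1 exhibits the products det A * x_i that Cramer's
   rule computes, without having to single out a coordinate of x that is apart
   from zero. *)
have -> : CRdet A == \big[CRplus R/0]_i (CRdet A * x i ord0 * x i ord0).
  rewrite -[X in X == _]CRmult_1_r -[X in _ * X == _](CRmult_1_r 1) -x1.
  by rewrite CRnorm_sqr CRsum_mull; apply: eq_CRsum => i; ring.
apply: CRle_trans (CRabs_sum _) _; rewrite CRsum_mull; apply: CRsum_le => i.
rewrite CRabs_mult -CRcofactor_mulmv -[e * _]CRmult_1_r.
set s := \big[CRplus R/0]_j (CRcofactor A j i * CRmulmv A x j ord0).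
apply: (CRle_trans _ (CRabs R s * 1)).
  apply: CRmult_le_compat_l; first exact: CRabs_pos.
  by rewrite -x1; exact: CRabs_le_norm.
apply: CRmult_le_compat_r; first exact: CRle_0_1.
apply: CRle_trans (CRabs_sum _) _; rewrite CRsum_mull; apply: CRsum_le => j.
rewrite CRabs_mult CRmult_comm.
apply: CRmult_le_compat_r; first exact: CRabs_pos.
exact: CRle_trans (CRabs_le_norm _ _) Axe.
Qed.

Lemma det_eq0_of_small n (A : 'M[CRcarrier R]_n) :
  (forall eps : CRcarrier R, 0 < eps ->
     {x : 'cV[CRcarrier R]_n & CRnorm x == 1 & CRnorm (CRmulmv A x) < eps}) ->
  CRdet A == 0.
Proof.
move=> small.
set C := \big[CRplus R/0]_i \big[CRplus R/0]_j CRabs R (CRcofactor A j i).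
have [c Cc] := CR_archimedean R C.
apply: CRabs_le0_eq0; apply: (CRle_of_arch _ _ c) => p.
have p0 : 0 < CR_of_Q R (1 # p) by apply: CR_of_Q_lt.
have [x x1 Axp] := small _ p0.
apply: CRle_trans (CRabs_det_le x1 (CRlt_asym _ _ Axp)) _.
rewrite CRplus_0_l CR_of_Q_mult.
by apply: CRmult_le_compat_l; exact: CRlt_asym.
Qed.

(** * A vanishing determinant yields arbitrarily small images *)

(** This is [n! M^n]; as a double big operator it matches the determinant term
    by term. *)
Definition det_bound (n : nat) M : CRcarrier R :=
  \big[CRplus R/0]_(s : 'S_n) \big[CRmult R/1]_(i < n) M.

Lemma det_bound_ge0 n M : 0 <= M -> 0 <= det_bound n M.
Proof.
move=> M0; apply: CRsum_ge0 => s; apply: (big_ind (fun a => 0 <= a)) => //.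
- exact: CRle_0_1.
- by move=> a b; exact: CRmult_le_0_compat.
Qed.

Lemma CRabs_det_bound n (B : 'M[CRcarrier R]_n) M :
  (forall i j, CRabs R (B i j) <= M) -> CRabs R (CRdet B) <= det_bound n M.
Proof.
move=> BM; apply: CRle_trans (CRabs_sum _) _; apply: CRsum_le => s.
rewrite CRabs_mult.
have -> : CRabs R (if odd_perm s then CRopp R 1 else 1) == 1.
  by case: ifP; rewrite ?CRabs_opp CRabs_right //; exact: CRle_0_1.
rewrite CRmult_1_l.
suff [] : 0 <= CRabs R (\big[CRmult R/1]_(i < n) B i (s i)) /\
  CRabs R (\big[CRmult R/1]_(i < n) B i (s i)) <=
  \big[CRmult R/1]_(i < n) M by [].
apply: (big_ind2 (fun a b => 0 <= CRabs R a /\ CRabs R a <= b)).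
- by rewrite CRabs_right; [split; first exact: CRle_0_1 | exact: CRle_0_1].
- move=> a b c d [a0 ab] [c0 cd]; split; first exact: CRabs_pos.
  rewrite CRabs_mult; apply: (CRle_trans _ (CRabs R a * d)).
    exact: CRmult_le_compat_l.
  by apply: CRmult_le_compat_r => //; exact: CRle_trans cd.
- by move=> i _; split; [exact: CRabs_pos | exact: BM].
Qed.

(** If [B] is singular, a kernel vector can be rescaled at will.  Otherwise the
    columns of [B^-1] are mapped to the basis vectors, and one of them has an
    entry above [M]: if all entries of [B^-1] were at most [M'], then
    [1 = |det B| |det B^-1|] would be at most [|det B| n! M'^n < 1]. *)
Lemma rat_stretch n (B : 'M[rat]_n) M M' :
  M < M' -> CRabs R (ratR (\det B)%R) * det_bound n M' < 1 ->
  {y : 'cV[rat]_n & {j : 'I_n & M < CRabs R (ratR (y j ord0))}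
    & forall i, CRabs R (ratR ((B *m y)%R i ord0)) <= 1}.
Proof.
move=> MM' detB; case: (eqVneq (\det B)%R 0%R) => [B0 | Bn0].
  have [v v0 vB] : {v : 'rV[rat]_n | v != 0%R & ((v *m B^T)%R == 0%R)%B}.
    apply: sig2W; move/eqP: B0; rewrite -det_tr => /det0P[v v0 /eqP vB].
    by exists v.
  have [j vj] : {j | v ord0 j != 0%R} by apply: sigW; exact/rV0Pn.
  have [q [Mq _]] := CR_Q_dense R _ _ MM'.
  exists ((rat_of_Q q / v ord0 j) *: v^T)%R.
    exists j; rewrite !mxE divfK // ratR_of_Q.
    by apply: CRlt_le_trans Mq _; exact: CRle_abs.
  move=> i; rewrite -scalemxAr -[B]trmxK -trmx_mul (eqP vB) trmx0 scaler0 mxE.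
  by rewrite ratR0 CRabs_right //; exact: CRle_0_1.
have [[[i j] Mij] | small] := exists_gt_or_all_le
  (fun ij : 'I_n * 'I_n => CRabs R (ratR (invmx B ij.1 ij.2))) MM'.
  exists (col j (invmx B)); first by exists i; rewrite mxE.
  move=> k; rewrite colE mulmxA mulmxV ?unitmxE ?unitfE // mul1mx mxE andbT.
  have one_ge0 := CRle_0_1.
  by case: ((k == j)%B); rewrite ?ratR0 ?ratR1 CRabs_right.
have inv_le : CRabs R (ratR (\det (invmx B))%R) <= det_bound n M'.
  rewrite ratR_det; apply: CRabs_det_bound => i j.
  by rewrite mxE; exact: (small (i, j)).
exfalso; suff: 1 <= CRabs R (ratR (\det B)%R) * det_bound n M' by move/(_ detB).
apply: CRle_trans (CRmult_le_compat_l _ _ _ (CRabs_pos _) inv_le).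
rewrite -CRabs_mult -ratRM det_inv mulfV // ratR1 CRabs_right //.
exact: CRle_0_1.
Qed.

(** In the bound [n / p + 1 / p], the first term comes from replacing [A] by a
    rational matrix with entries within [1 / p], and the second from a rational
    vector stretched beyond [p] and then normalized. *)
Lemma small_vector n (A : 'M[CRcarrier R]_n) (p : positive) :
  CRdet A == 0 ->
  {x : 'cV[CRcarrier R]_n & CRnorm x == 1
     & forall i, CRabs R (CRmulmv A x i ord0) <=
         CR_of_Q R ((Z.of_nat n # 1) * (1 # p)) + CR_of_Q R (1 # p)}.
Proof.
move=> detA0.
pose M := CR_of_Q R (Z.pos p # 1).
pose M' := CR_of_Q R (Z.pos (p + 1) # 1).
have MM' : M < M' by apply: CR_of_Q_lt; rewrite /Qlt /=; lia.
have M0 : 0 < M by apply: CR_of_Q_lt.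
have bound_ge0 : 0 <= det_bound n M'.
  by apply/det_bound_ge0/CRlt_asym; exact: CRlt_trans MM'.
have cv_det :
    CR_cv R (fun k => CRdet (map_mx ratR (rat_mx A k)) * det_bound n M') 0.
  rewrite -(CRmult_0_l (det_bound n M')) -detA0.
  apply: CR_cv_mult (CR_cv_const _).
  by apply: CR_cv_det => i j; exact: rat_mx_cv.
have [N detN] := cv_det 2%positive.
pose k := maxn N (Pos.to_nat p); pose B := rat_mx A k.
have AB i j : CRabs R (A i j - map_mx ratR B i j) <= CR_of_Q R (1 # p).
  by rewrite CRabs_minus_sym; apply: rat_mx_close; rewrite /k leq_maxr.
have detB : CRabs R (ratR (\det B)%R) * det_bound n M' < 1.
  apply: (CRle_lt_trans _ (CR_of_Q R (1 # 2))); last exact: CR_of_Q_lt.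
  have := detN k _; rewrite /CRminus CRopp_0 CRplus_0_r CRabs_mult => /(_ _).
  by rewrite [X in _ * X]CRabs_right // ratR_det; apply; rewrite /k; lia.
have [y [j Mj] By] := rat_stretch MM' detB.
pose y' : 'cV[CRcarrier R]_n := map_mx ratR y.
have Mnorm : M < CRnorm y'.
  by apply: CRlt_le_trans Mj _; have := CRabs_le_norm y' j; rewrite mxE.
have norm0 : 0 < CRnorm y' by exact: CRlt_trans Mnorm.
pose t := CRinv R (CRnorm y') (inr norm0).
have t0 : 0 < t by exact: CRinv_0_lt_compat.
have tnorm : t * CRnorm y' == 1 by exact: CRinv_l.
have tp : t <= CR_of_Q R (1 # p).
  apply: (CRmult_le_reg_r (CRnorm y')) => //; rewrite tnorm.
  have -> : 1 == CR_of_Q R (1 # p) * M.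
    rewrite -CR_of_Q_mult; apply: CR_of_Q_morph; rewrite /Qeq /=; lia.
  by apply: CRmult_le_compat_l; [apply: CR_of_Q_le | exact: CRlt_asym].
pose x : 'cV[CRcarrier R]_n := (\col_i (t * y' i ord0)%ConstructiveReals)%R.
have x1 : CRnorm x == 1 by rewrite CRnorm_scale //; exact: CRlt_asym.
exists x => // i.
apply: CRle_trans (CRabs_mulmv_le (AB i) _) _.
  by move=> l; rewrite -x1; exact: CRabs_le_norm.
rewrite CRsum_const; apply: CRplus_le_compat => //.
have -> : CRmulmv (map_mx ratR B) x i ord0 == t * ratR ((B *m y)%R i ord0).
  by rewrite ratR_mulmv CRmulmv_scale.
rewrite CRabs_mult CRabs_right; last exact: CRlt_asym.
rewrite -[CR_of_Q R (1 # p)]CRmult_1_r.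
apply: (CRle_trans _ (t * 1)).
  by apply: CRmult_le_compat_l => //; exact: CRlt_asym.
by apply: CRmult_le_compat_r => //; exact: CRle_0_1.
Qed.
End DetZero.

Theorem theorem5p8 (R : ConstructiveReals) (n : nat) (A : 'M[CRcarrier R]_n) :
  CRelationClasses.iffT
    (CRdet A == 0)
    (forall eps : CRcarrier R, 0 < eps ->
       {x : 'cV[CRcarrier R]_n & CRnorm x == 1 & CRnorm (CRmulmv A x) < eps}).
Proof.
split=> [detA0 eps eps0 | ]; last exact: det_eq0_of_small.
have [[a b] [q0 qeps]] := CR_Q_dense R _ _ eps0.
have a0 : Z.lt Z0 a by have := lt_CR_of_Q R _ _ q0; rewrite /Qlt /=; lia.
(* The norm of A x is at most n (n / p + 1 / p) = n (n + 1) / p, which is less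
   than 1 / b <= a / b < eps. *)
pose p := (b * (Pos.of_succ_nat n * Pos.of_succ_nat n))%positive.
have [x x1 Ax] := small_vector p detA0.
exists x => //; apply: CRlt_trans qeps.
apply: CRle_lt_trans; first exact: CRnorm_le_sum.
apply: CRle_lt_trans.
  by apply: CRsum_le => i; exact: Ax.
rewrite -(eq_CRsum (fun i => CR_of_Q_plus R _ _)) CRsum_const.
apply: CR_of_Q_lt; rewrite /p /Qlt /=; nia.
Qed.
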